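(* Let $G$ be a countable group. Then $G$ admits a relative order if and only if $G$ admits a non-trivial action by orientation-preserving homeomorphisms on the real line $\mathbb{R}$. Moreover, if $\preceq$ is a relative order of $G$ with respect to $C$, then there are an action (group homomorphism) $\rho_\preceq:G\to \mathrm{Homeo}_+(\mathbb{R})$ and a point $p\in\mathbb{R}$ such that $C=\{g\in G\mid \rho_\preceq(g)(p)=p\}$ and, for every $g\in G$, $$C\prec gC\iff p<\rho_\preceq(g)(p).$$
   Context: A proper subgroup $C$ of a group $G$ is relatively convex if there is a total order $\preceq$ on the set of left cosets $G/C$ which is invariant under left multiplication by $G$: if $fC\preceq gC$ then $hfC\preceq hgC$ for all $f,g,h\in G$. Such an order $\preceq$ is called a relative order of $G$ with respect to $C$. $G$ admits a relative order if there is a relative order with respect to some (proper) subgroup $C$. $\mathrm{Homeo}_+(\mathbb{R})$ is the group of orientation-preserving homeomorphisms of $\mathbb{R}$. *)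

(* Defs.v *)
From HB Require Import structures.
From mathcomp Require Import all_boot all_order all_algebra.
From mathcomp Require Import all_classical all_reals all_analysis.

Set Implicit Arguments.
Unset Strict Implicit.
Unset Printing Implicit Defensive.

Import Order.TTheory GRing.Theory Num.Theory.
Import numFieldNormedType.Exports.

Local Open Scope classical_set_scope.

Definition total_order_on (T : Type) (D : set T) (r : rel T) :=
  [/\ {in D, reflexive r}, {in D &, antisymmetric r},
      {in D & &, transitive r} & {in D &, total r}].

Definition strictly (T : Type) (r : rel T) (x y : T) := r x y /\ x <> y.

Section RelativeOrder.
Local Open Scope group_scope.
Variable G : groupType.
Implicit Types (C : set G) (g : G).

Definition subgroup C := group_closed [in C].

Definition left_coset g C : set G := [set g * c | c in C].

Definition left_cosets C : set (set G) := range (left_coset^~ C).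

(* [r] orders the left cosets of [C]; its values on the other subsets of [G]
   are irrelevant. *)
Definition relative_order C (r : rel (set G)) :=
  [/\ subgroup C, C `<` [set: G], total_order_on (left_cosets C) r &
      forall f g h : G, r (left_coset f C) (left_coset g C) ->
        r (left_coset (h * f) C) (left_coset (h * g) C)].

Definition relatively_convex C := exists r, relative_order C r.

Definition admits_relative_order := exists C, relatively_convex C.

End RelativeOrder.

Definition homeomorphism (S T : topologicalType) (f : S -> T) :=
  continuous f /\ exists f' : T -> S,
    [/\ continuous f', cancel f f' & cancel f' f].

Section Homeo.
Local Open Scope ring_scope.
Variable R : realType.

Definition orientation_preserving (f : R -> R) := {homo f : x y / x < y}.

Definition homeop_pred (f : R -> R) :=
  `[< homeomorphism f /\ orientation_preserving f >].

Record homeop := Homeop {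
  homeop_fun :> R -> R;
  homeopP : homeop_pred homeop_fun }.

HB.instance Definition _ := [isSub for homeop_fun].
HB.instance Definition _ := [Choice of homeop by <:].

Lemma homeop_id_subproof : homeop_pred idfun.
Proof.
by apply/asboolP; split=> //; split; [|exists idfun; split=> //] => x; exact: cvg_id.
Qed.

Lemma homeop_comp_subproof (f g : homeop) : homeop_pred (f \o g).
Proof.
have /asboolP[[cf [f' [cf' fK f'K]]] incf] := homeopP f.
have /asboolP[[cg [g' [cg' gK g'K]]] incg] := homeopP g.
apply/asboolP; split; last by move=> x y /incg/incf.
split; first by move=> x; apply: continuous_comp; [exact: cg|exact: cf].
exists (g' \o f'); split; last 2 first.
- exact: can_comp.
- exact: can_comp.
by move=> x; apply: continuous_comp; [exact: cf'|exact: cg'].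
Qed.

Lemma homeop_inv_subproof (f : homeop) :
  exists g : homeop, cancel f g /\ cancel g f.
Proof.
have /asboolP[[cf [f' [cf' fK f'K]]] incf] := homeopP f.
suff hf' : homeop_pred f' by exists (Homeop hf').
apply/asboolP; split; first by split=> //; exists f.
move=> x y xy; rewrite ltNge; apply/negP; rewrite le_eqVlt => /orP[/eqP e|/incf].
  by move: xy; rewrite -(f'K x) -(f'K y) e ltxx.
by rewrite !f'K => /(lt_trans xy); rewrite ltxx.
Qed.

Definition homeop_one := Homeop homeop_id_subproof.
Definition homeop_mul (f g : homeop) := Homeop (homeop_comp_subproof f g).
Definition homeop_inv (f : homeop) := sval (cid (homeop_inv_subproof f)).

Lemma homeop_mulA : associative homeop_mul.
Proof. by move=> f g h; apply: val_inj. Qed.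

Lemma homeop_mul1 : left_id homeop_one homeop_mul.
Proof. by move=> f; apply: val_inj. Qed.

Lemma homeop_mulr1 : right_id homeop_one homeop_mul.
Proof. by move=> f; apply: val_inj. Qed.

Lemma homeop_mulV : left_inverse homeop_one homeop_inv homeop_mul.
Proof.
move=> f; apply: val_inj; rewrite /= /homeop_inv; case: cid => g [/= fK _].
exact/funext.
Qed.

Lemma homeop_mulrV : right_inverse homeop_one homeop_inv homeop_mul.
Proof.
move=> f; apply: val_inj; rewrite /= /homeop_inv; case: cid => g [/= _ gK].
exact/funext.
Qed.

HB.instance Definition _ := isGroup.Build homeop
  homeop_mulA homeop_mul1 homeop_mulr1 homeop_mulV homeop_mulrV.

Definition nontrivial_action (G : groupType)
    (rho : {multiplicative G -> homeop}) := exists g, rho g <> 1%g.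

End Homeo.

(* Main.v *)
(* A relative order makes G x Q, ordered lexicographically, a countable dense
   weak order without endpoints, on which G acts by left translation of the
   first factor.  By Cantor's back-and-forth argument it maps onto Q, identifying
   only the points that the weak order does not separate, so G acts by increasing
   bijections on a dense subset of R.  These extend uniquely to increasing
   bijections, hence homeomorphisms, of R, and p is the image of (1, 0).
   Weak orders on G replace total orders on G/C, which avoids quotients.
   Conversely, the stabilizer of a point p moved by an action is relatively
   convex, its cosets being ordered by g p <= h p. *)

From HB Require Import structures.
Require Import Defs.
From mathcomp Require Import all_boot all_order all_algebra.
From mathcomp Require Import all_classical all_reals all_analysis.

Set Implicit Arguments.
Unset Strict Implicit.
Unset Printing Implicit Defensive.

Import Order.TTheory GRing.Theory Num.Theory.
Import numFieldNormedType.Exports.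

Local Open Scope classical_set_scope.

(** * Dense weak orders without endpoints *)

(** The third clause, negative transitivity, makes incomparability an equivalence relation, so this
    is a strict dense linear order without endpoints on the classes. *)
Definition dense_weak_order (T : Type) (lt : rel T) :=
  [/\ irreflexive lt, transitive lt,
      forall x y z, lt x y -> lt x z || lt z y,
      forall x y, lt x y -> exists2 z, lt x z & lt z y &
      forall x, exists y z, lt y x /\ lt x z].

Lemma dense_weak_order_converse (T : Type) (lt : rel T) :
  dense_weak_order lt -> dense_weak_order (fun x y => lt y x).
Proof.
move=> [irr tr ntr dn ub]; split=> //.
- by move=> y x z xy yz; exact: tr yz xy.
- by move=> x y z /(ntr _ _ z); rewrite orbC.
- by move=> x y /dn[z xz zy]; exists z.
- by move=> x; have [y [z [yx xz]]] := ub x; exists z, y.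
Qed.

Lemma dense_weak_order_max (T : eqType) (lt : rel T) (x : T) (A : seq T) :
  dense_weak_order lt ->
  exists2 m, m \in x :: A & {in x :: A, forall a, ~~ lt m a}.
Proof.
move=> [irr tr ntr _ _]; elim: A x => [|a A IH] x.
  by exists x; rewrite ?mem_seq1// => a; rewrite mem_seq1 => /eqP->; rewrite irr.
have [m mA maxm] := IH a.
have [ltmx|nltmx] := boolP (lt m x).
  exists x => [|b]; first exact: mem_head.
  rewrite inE => /predU1P[->|/maxm]; first by rewrite irr.
  by apply: contra; exact: tr.
exists m => [|b]; first by rewrite inE mA orbT.
by rewrite inE => /predU1P[->//|/maxm].
Qed.

(** Density separates a maximal element of [A] from a minimal one of [B]; if one list is empty, the
    absence of endpoints replaces density. Negative transitivity passes the bound on to the other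
    elements. [x0] serves when both lists are empty. *)
Lemma dense_weak_order_between (T : eqType) (lt : rel T) (x0 : T)
    (A B : seq T) : dense_weak_order lt ->
  {in A & B, forall a b, lt a b} ->
  exists2 z, {in A, forall a, lt a z} & {in B, forall b, lt z b}.
Proof.
move=> wlt AB; have [irr tr ntr dn ub] := wlt.
have above m z (s : seq T) : {in s, forall a, ~~ lt m a} -> lt m z ->
    {in s, forall a, lt a z}.
  by move=> maxm mz a /maxm/negbTE mNa; have := ntr _ _ a mz; rewrite mNa.
have below m z (s : seq T) : {in s, forall a, ~~ lt a m} -> lt z m ->
    {in s, forall a, lt z a}.
  by move=> minm zm a /minm/negbTE mNa; have := ntr _ _ a zm; rewrite mNa orbF.
have wgt := dense_weak_order_converse wlt.
case: A AB => [|a A] AB; case: B AB => [|b B] AB.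
- by exists x0.
- have [m _ minm] := dense_weak_order_max b B wgt.
  by have [y [_ [ym _]]] := ub m; exists y => //; exact: below ym.
- have [m _ maxm] := dense_weak_order_max a A wlt.
  by have [_ [z [_ mz]]] := ub m; exists z => //; exact: above mz.
have [m mA maxm] := dense_weak_order_max a A wlt.
have [n nB minn] := dense_weak_order_max b B wgt.
have [z mz zn] := dn _ _ (AB _ _ mA nB).
by exists z; [exact: above mz|exact: below zn].
Qed.

(** * Cantor's back-and-forth construction *)

(** The pairs need not form a function: incomparable points may share a partner or have distinct
    incomparable ones. *)
Definition partial_iso (T U : eqType) (ltT : rel T) (ltU : rel U)
    (s : seq (T * U)) := {in s &, forall a b, ltT a.1 b.1 = ltU a.2 b.2}.

(** If [x] is incomparable to a point already matched, the partner of that point serves. Otherwise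
    [x] cuts the list into points below and points above, whose partners leave room for [u] between
    them. *)
Lemma partial_iso_extend (T U : eqType) (ltT : rel T) (ltU : rel U) (u0 : U)
    (s : seq (T * U)) (x : T) :
  dense_weak_order ltT -> dense_weak_order ltU -> partial_iso ltT ltU s ->
  exists u, partial_iso ltT ltU ((x, u) :: s).
Proof.
move=> wT wU iso_s; have [irrT trT ntrT _ _] := wT; have [irrU trU ntrU _ _] := wU.
suff [u su] : exists u, {in s, forall a,
    ltT x a.1 = ltU u a.2 /\ ltT a.1 x = ltU a.2 u}.
  exists u => a b; rewrite !inE => /predU1P[->|sa] /predU1P[->|sb] /=.
  - by rewrite irrT irrU.
  - by have [] := su _ sb.
  - by have [] := su _ sa.
  - exact: iso_s.
have [/hasP[[c d] scd /= /andP[/negbTE xc /negbTE cx]]|/hasPn sx] :=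
    boolP (has (fun a => ~~ ltT x a.1 && ~~ ltT a.1 x) s).
  exists d => a sa; rewrite -(iso_s _ _ scd sa) -(iso_s _ _ sa scd) /=.
  split; apply/idP/idP.
  - by move/(ntrT _ _ c); rewrite xc.
  - by move/(ntrT _ _ x); rewrite cx.
  - by move/(ntrT _ _ c); rewrite cx orbF.
  - by move/(ntrT _ _ x); rewrite xc orbF.
have [|u Au uB] := @dense_weak_order_between _ ltU u0
    [seq a.2 | a <- s & ltT a.1 x] [seq a.2 | a <- s & ltT x a.1] wU.
  move=> _ _ /mapP[a + ->] /mapP[b + ->].
  rewrite !mem_filter => /andP[ax sa] /andP[xb sb].
  by rewrite -iso_s//; exact: trT xb.
exists u => a sa; have := sx _ sa; rewrite negb_and !negbK.
case/orP => ltxa.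
  have ua : ltU u a.2 by apply/uB/map_f; rewrite mem_filter ltxa.
  rewrite ltxa ua; split=> //; rewrite (_ : ltT _ _ = false); last first.
    by apply/negP => /(trT _ _ _ ltxa); rewrite irrT.
  by apply/esym/negP => /(trU _ _ _ ua); rewrite irrU.
have ua : ltU a.2 u by apply/Au/map_f; rewrite mem_filter ltxa.
rewrite ltxa ua; split=> //; rewrite (_ : ltT _ _ = false); last first.
  by apply/negP => /(trT _ _ _)/(_ ltxa); rewrite irrT.
by apply/esym/negP => /(trU _ _ _)/(_ ua); rewrite irrU.
Qed.

Lemma partial_iso_swap (T U : eqType) (ltT : rel T) (ltU : rel U)
    (s : seq (T * U)) :
  partial_iso ltT ltU s -> partial_iso ltU ltT [seq (a.2, a.1) | a <- s].
Proof. by move=> iso_s _ _ /mapP[a sa ->] /mapP[b sb ->]; rewrite -iso_s. Qed.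

Lemma partial_iso_subset (T U : eqType) (ltT : rel T) (ltU : rel U)
    (s s' : seq (T * U)) : {subset s <= s'} ->
  partial_iso ltT ltU s' -> partial_iso ltT ltU s.
Proof. by move=> ss' iso a b /ss' sa /ss' sb; exact: iso. Qed.

(* Back and forth; [f] and [g] enumerate the two orders. *)
Lemma cantor_iso (T U : eqType) (ltT : rel T) (ltU : rel U)
    (f : T -> nat) (g : U -> nat) (x0 : T) (u0 : U) :
  injective f -> injective g -> dense_weak_order ltT -> dense_weak_order ltU ->
  exists (t : T -> U), (forall x y, ltT x y = ltU (t x) (t y)) /\
    forall u, exists x, ~~ ltU (t x) u /\ ~~ ltU u (t x).
Proof.
move=> injf injg wT wU.
have [irrU _ _ _ _] := wU; have [irrT _ _ _ _] := wT.
have forth n s : partial_iso ltT ltU s -> exists s', [/\ partial_iso ltT ltU s',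
    {subset s <= s'} & forall x, f x = n -> exists u, (x, u) \in s'].
  move=> iso_s; have [[x fx]|nx] := pselect (exists x, f x = n).
    have [u iso_u] := partial_iso_extend u0 x wT wU iso_s.
    exists ((x, u) :: s); split=> // [a sa|y]; first by rewrite inE sa orbT.
    by rewrite -fx => /injf->; exists u; exact: mem_head.
  by exists s; split=> // x fx; case: nx; exists x.
have back n s : partial_iso ltT ltU s -> exists s', [/\ partial_iso ltT ltU s',
    {subset s <= s'} & forall u, g u = n -> exists x, (x, u) \in s'].
  move=> iso_s; have [[u gu]|nu] := pselect (exists u, g u = n).
    have [x iso_x] := partial_iso_extend x0 u wU wT (partial_iso_swap iso_s).
    exists ((x, u) :: s); split=> [|a sa|y].
    - apply: partial_iso_subset (partial_iso_swap iso_x) => -[c d].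
      rewrite /= !inE => /predU1P[[-> ->]|scd]; first by rewrite eqxx.
      apply/orP; right; apply/mapP; exists (d, c) => //.
      by apply/mapP; exists (c, d).
    - by rewrite inE sa orbT.
    - by rewrite -gu => /injg->; exists x; exact: mem_head.
  by exists s; split=> // u gu; case: nu; exists u.
(* The invariant is a premise so that [step] is total; any list will do where it fails. *)
have /choice[step stepP] : forall ns : nat * seq (T * U), exists s',
    partial_iso ltT ltU ns.2 -> [/\ partial_iso ltT ltU s',
    {subset ns.2 <= s'}, forall x, f x = ns.1 -> exists u, (x, u) \in s' &
    forall u, g u = ns.1 -> exists x, (x, u) \in s'].
  move=> [n s] /=; have [iso_s|] := pselect (partial_iso ltT ltU s); last first.
    by exists s.
  have [s1 [iso1 ss1 fs1]] := forth n s iso_s.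
  have [s2 [iso2 s12 gs2]] := back n s1 iso1.
  exists s2 => _; split=> // [a /ss1/s12//|x /fs1[u /s12]].
  by exists u.
(* The passage from [S n] to [S n.+1] treats the points of code [n], so [x] is matched in
   [S (f x).+1]. *)
pose S := fix S n := if n is m.+1 then step (m, S m) else [::].
have isoS n : partial_iso ltT ltU (S n).
  by elim: n => [|n IH] //=; case: (stepP (n, S n) IH).
have subS m n : (m <= n)%N -> {subset S m <= S n}.
  elim: n => [|n IH]; first by rewrite leqn0 => /eqP->.
  rewrite leq_eqVlt => /predU1P[->//|]; rewrite ltnS => /IH{}IH a /IH Sa.
  by case: (stepP (n, S n) (isoS n)) => _ + _ _; apply.
have /choice[t tP] : forall x, exists u, (x, u) \in S (f x).+1.
  by move=> x; case: (stepP (f x, S (f x)) (isoS _)) => _ _ + _; apply.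
have isoSS m n a b : a \in S m -> b \in S n -> ltT a.1 b.1 = ltU a.2 b.2.
  move=> Sa Sb; apply: (isoS (maxn m n)).
    by apply: subS Sa; rewrite leq_maxl.
  by apply: subS Sb; rewrite leq_maxr.
exists t; split=> [x y|u]; first exact: isoSS (tP x) (tP y).
have [x Sxu] : exists x, (x, u) \in S (g u).+1.
  by case: (stepP (g u, S (g u)) (isoS _)) => _ _ _; apply.
(* [(x, t x)] and [(x, u)] both occur, so irreflexivity at [x] makes [t x] and [u] incomparable. *)
exists x; split.
  by rewrite -(isoSS _ _ _ _ (tP x) Sxu) /= irrT.
by rewrite -(isoSS _ _ _ _ Sxu (tP x)) /= irrT.
Qed.

Local Open Scope ring_scope.

(** * Rationals, lexicographic fattening and dense embedding *)

Lemma rat_dense_weak_order : dense_weak_order (fun x y : rat => x < y).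
Proof.
split=> [x|y x z|x y z xy|x y xy|x]; first exact: ltxx.
- exact: lt_trans.
- by have [//|/le_lt_trans->] := ltP x z.
- by exists ((x + y) / 2%:R); rewrite ?midf_lt.
- by exists (x - 1), (x + 1); rewrite ltrBlDr ltrDl ltr01.
Qed.

(* Fattening every class to a copy of the rationals removes gaps and endpoints. *)
Definition lexi_rat (T : Type) (lt : rel T) : rel (T * rat) := fun a b =>
  lt a.1 b.1 || ~~ lt b.1 a.1 && (a.2 < b.2).

Lemma lexi_rat_dense_weak_order (T : Type) (lt : rel T) :
  irreflexive lt -> transitive lt ->
  (forall x y z, lt x y -> lt x z || lt z y) -> dense_weak_order (lexi_rat lt).
Proof.
move=> irr tr ntr; rewrite /lexi_rat; split.
- by move=> [x q] /=; rewrite irr ltxx.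
- move=> [y q2] [x q1] [z q3] /= /orP[xy|/andP[nyx q12]] /orP[yz|/andP[nzy q23]].
  + by rewrite (tr _ _ _ xy yz).
  + by move: (ntr _ _ z xy); rewrite (negbTE nzy) orbF => ->.
  + by move: (ntr _ _ x yz); rewrite (negbTE nyx) => /= ->.
  + rewrite (lt_trans q12 q23) andbT; apply/orP; right.
    by apply/negP => /(ntr _ _ y); rewrite (negbTE nyx) (negbTE nzy).
- move=> [x q1] [y q2] [z q3] /= /orP[xy|/andP[nyx q12]].
    by case/orP: (ntr _ _ z xy) => ->; rewrite ?orbT.
  have [//|nxz] := boolP (lt x z); have [zy|nzy] := boolP (lt z y).
    by rewrite orbT.
  (* Here [x], [y] and [z] turn out to lie in one class, so the rational coordinates decide. *)
  rewrite !orFb; have [zx|_] := boolP (lt z x).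
    by move: (ntr _ _ y zx); rewrite (negbTE nzy) (negbTE nyx).
  have [yz|_] := boolP (lt y z).
    by move: (ntr _ _ x yz); rewrite (negbTE nyx) (negbTE nxz).
  by have [//|/le_lt_trans->] := ltP q1 q3.
- move=> [x q1] [y q2] /= /orP[xy|/andP[nyx q12]].
    by exists (x, q1 + 1); rewrite /= ?xy// irr ltrDl ltr01.
  by exists (x, (q1 + q2) / 2%:R); rewrite /= ?irr ?nyx ?midf_lt ?orbT.
- move=> [x q]; exists (x, q - 1), (x, q + 1).
  by rewrite /= irr ltrBlDr ltrDl ltr01.
Qed.

(** Incomparable rationals are equal, so the back-and-forth map onto the classes of the rationals
    hits every rational, and the rationals are dense in [R]. *)
Lemma dense_embedding (R : realType) (T : choiceType) (lt : rel T) (x0 : T) :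
  countable [set: T] -> irreflexive lt -> transitive lt ->
  (forall x y z, lt x y -> lt x z || lt z y) ->
  exists t : T * rat -> R, (forall a b, lexi_rat lt a b = (t a < t b)) /\
    forall x y, x < y -> exists a, x < t a < y.
Proof.
move=> /countable_injP[f injf] irr tr ntr.
have injF : injective (fun a : T * rat => pickle (f a.1, a.2)).
  move=> [x q] [y q'] /(pcan_inj pickleK)[fxy ->].
  by rewrite (injf x y)// inE.
have [t [tlt tsurj]] := cantor_iso (x0, 0) 0 injF (pcan_inj (@pickleK rat))
  (lexi_rat_dense_weak_order irr tr ntr) rat_dense_weak_order.
exists (ratr \o t); split=> [a b|x y xy]; first by rewrite tlt /= ltr_rat.
have [q] := rat_in_itvoo xy; rewrite in_itv /= => qxy.
have [a] := tsurj q; rewrite -!leNgt => -[qa aq]; exists a.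
by rewrite (@le_anti _ _ (t a) q) ?qa ?aq.
Qed.

(** * Increasing extensions from a dense set *)

Section Extension.
Variables (R : realType) (I : Type) (t : I -> R).
Hypothesis dense_t : forall x y, x < y -> exists i, x < t i < y.

(* The property pins [y] down: it is the value at [x] of the increasing
   extension of [t i |-> t (g i)]. *)
Definition extends_at (g : I -> I) (x y : R) :=
  forall i, (t i < x) = (t (g i) < y).

Lemma extends_at_ex (g : I -> I) (x : R) :
  (forall i j, (t (g i) < t (g j)) = (t i < t j)) -> exists y, extends_at g x y.
Proof.
move=> monog; pose S := [set t (g i) | i in [set i | t i < x]].
have supS : has_sup S.
  split.
    have [|i /andP[_ ix]] := dense_t (x := x - 1) (y := x).
      by rewrite ltrBlDr ltrDl ltr01.
    by exists (t (g i)), i.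
  have [|j /andP[xj _]] := dense_t (x := x) (y := x + 1).
    by rewrite ltrDl ltr01.
  by exists (t (g j)) => _ [i /= ix <-]; rewrite ltW// monog (lt_trans ix).
exists (sup S) => i; apply/idP/idP => [ix|].
  (* The supremum is only a weak bound; an intermediate [t j] makes the inequality strict. *)
  have [j /andP[ij jx]] := dense_t ix.
  rewrite (@lt_le_trans _ _ (t (g j))) ?monog//.
  by apply: sup_upper_bound => //; exists j.
move=> /(sup_gt supS.1)[_ [j /= jx <-]]; rewrite monog => ij.
exact: lt_trans jx.
Qed.

Lemma extends_at_lt (g : I -> I) (x x' y y' : R) :
  extends_at g x y -> extends_at g x' y' -> x < x' -> y < y'.
Proof.
move=> gxy gx'y' xx'.
have [k /andP[xk kx']] := dense_t xx'.
have := gxy k; rewrite (lt_gtF xk) => /esym/negbT; rewrite -leNgt.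
by move=> /le_lt_trans; apply; rewrite -gx'y'.
Qed.

(** Surjectivity of [g] is what counts: a point [t i] between two candidates is [t (g (g' i))], and
    then [t (g' i)] would be both below [x] and not below it. *)
Lemma extends_at_unique (g g' : I -> I) (x y y' : R) : cancel g' g ->
  extends_at g x y -> extends_at g x y' -> y = y'.
Proof.
move=> g'K; wlog yy' : y y' / y < y'.
  by move=> wl gy gy'; have [/wl->//|/wl->//|//] := ltgtP y y'.
move=> gy gy'; have [i /andP[yi iy']] := dense_t yy'.
have := gy (g' i); rewrite gy' g'K iy' => /esym.
by rewrite (lt_gtF yi).
Qed.

End Extension.

Lemma increasing_bijection_continuous (R : realType) (f f' : R -> R) :
  {homo f : x y / x < y} -> {homo f' : x y / x < y} ->
  cancel f f' -> cancel f' f -> continuous f.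
Proof.
move=> incf incf' fK f'K x; apply/cvgrPdist_lt => e e0.
(* The preimages of [f x - e] and [f x + e] bound an open interval around [x] that [f] sends into
   the [e]-ball. *)
have lx : f' (f x - e) < x by rewrite -[ltRHS]fK incf'// ltrBlDr ltrDl.
have xr : x < f' (f x + e) by rewrite -[ltLHS]fK incf'// ltrDl.
near=> y; rewrite ltr_distlC; apply/andP; split.
  by rewrite -[ltLHS]f'K incf//; near: y; exact: lt_nbhsr.
by rewrite -[ltRHS]f'K incf//; near: y; exact: lt_nbhsl.
Unshelve. all: by end_near. Qed.

(** * Extending an action to the line *)

Section ActionExtension.
Local Open Scope group_scope.
Variables (R : realType) (G : groupType) (I : Type) (t : I -> R).
Variable act : G -> I -> I.
Hypothesis dense_t : forall x y : R, (x < y)%R -> exists i, (x < t i < y)%R.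
Hypothesis act1 : forall i, act 1 i = i.
Hypothesis actM : forall g h i, act (g * h) i = act g (act h i).
Hypothesis mono_act : forall g i j,
  (t (act g i) < t (act g j))%R = (t i < t j)%R.

Lemma actVK g : cancel (act g^-1) (act g).
Proof. by move=> i; rewrite -actM mulgV act1. Qed.

(** Uniqueness of the extensions yields the action laws: the identity extends [act 1], and the
    composite of the extensions of [act g] and [act h] extends [act (g * h)]. The inverse of an
    extension is then the extension for the inverse. *)
Lemma action_extension :
  exists rho : {multiplicative G -> homeop R}, forall g i,
    rho g (t i) = t (act g i).
Proof.
have /choice[F FP] : forall gx : G * R, exists y,
    extends_at t (act gx.1) gx.2 y.
  by move=> [g x]; apply: extends_at_ex => // i j; exact: mono_act.
have F_eq g x y : extends_at t (act g) x y -> F (g, x) = y.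
  exact: (extends_at_unique dense_t (actVK g) (FP (g, x))).
have F1 x : F (1, x) = x by apply: F_eq => i; rewrite act1.
have FM g h x : F (g * h, x) = F (g, F (h, x)).
  by apply: F_eq => i; rewrite actM -(FP (g, F (h, x))) -(FP (h, x)).
have Flt g : {homo (fun x => F (g, x)) : x y / (x < y)%R}.
  by move=> x y; exact: (extends_at_lt dense_t (FP (g, x)) (FP (g, y))).
have FK g : cancel (fun x => F (g, x)) (fun x => F (g^-1, x)).
  by move=> x; rewrite -FM mulVg F1.
have FVK g : cancel (fun x => F (g^-1, x)) (fun x => F (g, x)).
  by move=> x; rewrite -FM mulgV F1.
have FH g : homeop_pred (fun x => F (g, x)).
  apply/asboolP; split; last exact: Flt.
  split.
    exact: increasing_bijection_continuous (Flt g) (Flt g^-1) (FK g) (FVK g).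
  exists (fun x => F (g^-1, x)); split=> //.
  exact: increasing_bijection_continuous (Flt g^-1) (Flt g) (FVK g) (FK g).
pose rho g := Homeop (FH g).
have rhoM : {morph rho : x y / x * y}.
  by move=> g h; apply/val_inj/funext => x; exact: (FM g h x).
pose rhoMixin := isMultiplicative.Build G (homeop R) rho rhoM.
pose rhoMul : {multiplicative G -> homeop R} := HB.pack rho rhoMixin.
exists rhoMul => g i; apply: F_eq => j /=.
by rewrite mono_act.
Qed.

End ActionExtension.

(** * Equality of cosets *)

Section Cosets.
Local Open Scope group_scope.
Variables (G : groupType) (C : set G).
Hypothesis sgC : subgroup C.

Lemma left_coset_eqP g h : left_coset g C = left_coset h C <-> C (g^-1 * h).
Proof.
have [C1 CB] := sgC.
have CM x y : C x -> C y -> C (x * y).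
  by move=> Cx Cy; have := group_closedM sgC; move=> /(_ x y); rewrite !inE; exact.
have CV x : C x -> C x^-1.
  by move=> Cx; have := group_closedV sgC; move=> /(_ x); rewrite !inE; exact.
split=> [|Cgh].
  move=> /seteqP[_ /(_ h)[|c Cc <-]]; last by rewrite mulKg.
  by exists 1; rewrite ?mulg1//; move: C1; rewrite inE.
apply/seteqP; split=> _ [c Cc <-].
  exists ((g^-1 * h)^-1 * c); first exact/CM/Cc/CV.
  by rewrite invgM invgK -!mulgA mulVKg.
by exists (g^-1 * h * c); [exact: CM|rewrite !mulgA mulgV mul1g].
Qed.

Lemma left_coset1 : left_coset 1 C = C.
Proof.
apply/seteqP; split=> [_ [c Cc <-]|c Cc]; first by rewrite mul1g.
by exists c; rewrite ?mul1g.
Qed.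

End Cosets.

(** * From relative orders to actions and back *)

Lemma relative_order_action (R : realType) (G : groupType) (C : set G)
    (r : rel (set G)) : countable [set: G] -> relative_order C r ->
  exists (rho : {multiplicative G -> homeop R}) (p : R),
    C = [set g | rho g p = p] /\
    forall g : G, strictly r C (left_coset g C) <-> p < rho g p.
Proof.
move=> countG [sgC _ [rxx ranti rtr rtot] rM].
have inD g : left_coset g C \in left_cosets C by rewrite inE; exists g.
(* The strict coset order pulled back to [G]; two elements are incomparable exactly when their
   cosets coincide. *)
pose lt g h := ~~ r (left_coset h C) (left_coset g C).
have irr : irreflexive lt by move=> g; rewrite /lt rxx.
have ntr x y z : lt x y -> lt x z || lt z y.
  by rewrite /lt -negb_and; apply: contra => /andP[zx yz]; exact: rtr zx.
have asym x y : lt x y -> ~~ lt y x.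
  by rewrite /lt negbK => /negbTE yx; have := rtot _ _ (inD x) (inD y); rewrite yx orbF.
have tr : transitive lt.
  by move=> y x z xy /[dup] yz /(ntr _ _ x)/orP[|//]; rewrite (negbTE (asym _ _ xy)).
have ltM (h f g : G) : lt (h * f)%g (h * g)%g = lt f g.
  apply/idP/idP; apply: contra; first exact: rM.
  by move/(rM _ _ h^-1%g); rewrite !mulKg.
have [t [tlt dense_t]] := dense_embedding R 1%g countG irr tr ntr.
pose act (g : G) (a : G * rat) := (g * a.1, a.2)%g.
have [||g a b|rho rhoE] := @action_extension R G _ t act dense_t.
- by move=> [x q]; rewrite /act mul1g.
- by move=> g h [x q]; rewrite /act mulgA.
- by rewrite -!tlt /lexi_rat /= !ltM.
pose p := t (1%g, 0).
have rhop g : rho g p = t (g, 0) by rewrite rhoE /act mulg1.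
(* Both points have rational coordinate 0, so [lexi_rat] reduces to [lt]. *)
have pl g : (p < rho g p) = lt 1%g g.
  by rewrite rhop -tlt /lexi_rat /= ltxx andbF orbF.
have pg g : (rho g p < p) = lt g 1%g.
  by rewrite rhop -tlt /lexi_rat /= ltxx andbF orbF.
have cosetC g : C g <-> C = left_coset g C.
  by have := left_coset_eqP sgC 1%g g; rewrite left_coset1 invg1 mul1g => -[].
have inC : C \in left_cosets C by have := inD 1%g; rewrite left_coset1.
exists rho, p; split.
  apply/seteqP; split=> g /=.
    move=> /cosetC gC; apply/eqP; rewrite eq_le !leNgt pl pg /lt -gC.
    by rewrite left_coset1 rxx.
  (* If [p] is fixed, neither coset strictly precedes the other, and antisymmetry identifies
     them. *)
  move=> rgp; apply/cosetC/ranti => //.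
  have := ltxx p; rewrite -{2}rgp pl => /negbT; rewrite negbK left_coset1 => ->.
  by have := ltxx p; rewrite -{1}rgp pg => /negbT; rewrite negbK left_coset1 => ->.
move=> g; rewrite pl /lt left_coset1 /strictly; split.
  by move=> [Cg nCg]; apply/negP => gC; apply: nCg; apply: ranti => //; rewrite Cg.
move=> ngC; split.
  by have := rtot _ _ inC (inD g); rewrite (negbTE ngC) orbF.
by move=> e; move: ngC; rewrite -e rxx.
Qed.

Lemma multiplicative1 (G H : groupType) (f : {multiplicative G -> H}) :
  (f 1 = 1)%g.
Proof. by apply: (@mulgI _ (f 1)%g); rewrite -gmulfM !mulg1. Qed.

Lemma nontrivial_action_relative_order (R : realType) (G : groupType)
    (rho : {multiplicative G -> homeop R}) :
  nontrivial_action rho -> admits_relative_order G.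
Proof.
move=> [g0 rho_g0].
have [p pg0] : exists p, rho g0 p <> p.
  apply/existsNP => fixp; apply: rho_g0; apply/val_inj/funext => x.
  exact: fixp.
have rhoM g h x : rho (g * h)%g x = rho g (rho h x) by rewrite gmulfM.
have rho1 x : rho 1%g x = x by rewrite multiplicative1.
have rholt g : {homo rho g : x y / x < y}.
  by have /asboolP[] := homeopP (rho g).
have rhole g : {homo rho g : x y / x <= y}.
  by apply: ltW_homo; exact: rholt.
pose C := [set g | rho g p = p].
(* The order must be defined on sets. On a coset of the stabilizer [C] the value [rho a p] does not
   depend on the representative [a], which is what [rE] exploits. *)
pose r : rel (set G) := fun A B =>
  `[< exists a b, [/\ A a, B b & rho a p <= rho b p] >].
have C1 : C 1%g by exact: rho1.
have sgC : subgroup C.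
  split=> [|g h]; first by rewrite inE.
  rewrite !inE /C /= => gp hp.
  by rewrite rhoM -[X in rho h^-1%g X]hp -(rhoM h^-1%g) mulVg rho1.
have rE g h : r (left_coset g C) (left_coset h C) = (rho g p <= rho h p).
  apply/asboolP/idP => [[_ [_ [[c Cc <-] [d Cd <-]]]]|gh].
    by rewrite !rhoM Cc Cd.
  by exists g, h; split=> //; exists 1%g; rewrite ?mulg1.
exists C, r; split=> //.
- by split=> // /(_ g0 I).
- split.
  + by move=> A /set_mem[g _ <-]; rewrite rE.
  + move=> A B /set_mem[g _ <-] /set_mem[h _ <-]; rewrite !rE => /le_anti gh.
    by apply/(left_coset_eqP sgC); rewrite /C /= rhoM -gh -rhoM mulVg rho1.
  + move=> A B D /set_mem[g _ <-] /set_mem[h _ <-] /set_mem[k _ <-].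
    by rewrite !rE; exact: le_trans.
  + move=> A B /set_mem[g _ <-] /set_mem[h _ <-].
    by rewrite !rE; exact: le_total.
- by move=> f g h; rewrite !rE !rhoM; exact: rhole.
Qed.

Theorem proposition2p2 (R : realType) (G : groupType)
    (countG : countable [set: G]) :
  (admits_relative_order G <->
    exists rho : {multiplicative G -> homeop R}, nontrivial_action rho)
  /\
  (forall (C : set G) (r : rel (set G)), relative_order C r ->
    exists (rho : {multiplicative G -> homeop R}) (p : R),
      C = [set g | rho g p = p] /\
      forall g : G, strictly r C (left_coset g C) <-> p < rho g p).
Proof.
split; last by move=> C r; exact: relative_order_action.
split=> [[C [r Cr]]|[rho]]; last exact: nontrivial_action_relative_order.
have [rho [p [Cp _]]] := relative_order_action R countG Cr.
have [_ [_ nTC] _ _] := Cr.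
(* As [C] is the stabilizer of [p] and proper, an element outside it moves [p], whence
   non-triviality. *)
have [g nCg] : exists g, ~ C g.
  by apply/existsNP => CT; apply: nTC => g _; exact: CT.
by exists rho, g => rhog; apply: nCg; rewrite Cp /= rhog.
Qed.
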